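(* Let $\alpha>-1/2$, let $n$ be a positive integer, and let $-1=\tau_0<\tau_1<\dots<\tau_n$ be the Gegenbauer-Gauss-Radau (GGR) points with Christoffel numbers $\varpi_0,\dots,\varpi_n$. Then the barycentric weights $\xi_i=1/\prod_{j\neq i}(\tau_j-\tau_i)$ corresponding to the interior GGR points $\tau_1,\dots,\tau_n$ are given by $$\xi_i=(-1)^{i-1}\sin\!\Bigl(\tfrac12\cos^{-1}\tau_i\Bigr)\sqrt{2\varpi_i}=(-1)^{i-1}\sin\!\bigl(\cos^{-1}\tau_i\bigr)\sqrt{\frac{\varpi_i}{1+\tau_i}},\qquad i=1,2,\dots,n.$$
   Context: For $\alpha>-1/2$, $G_n^{(\alpha)}$ denotes the degree-$n$ Gegenbauer polynomial (orthogonal on $[-1,1]$ with respect to the weight $(1-\tau^2)^{\alpha-1/2}$), normalized by $G_n^{(\alpha)}(1)=1$. The GGR points are the $n+1$ zeros $-1=\tau_0<\tau_1<\dots<\tau_n$ of $\mathcal{G}_{n+1}^{(\alpha)}=G_n^{(\alpha)}+G_{n+1}^{(\alpha)}$. The Christoffel numbers of the GGR quadrature on $[-1,1]$ are $\varpi_0=(\alpha+\tfrac12)\vartheta_0$ and $\varpi_j=\vartheta_j$ for $j=1,\dots,n$, where $$\vartheta_j=2^{2\alpha-1}\frac{\Gamma^2(\alpha+\frac12)\,n!}{(n+\alpha+\frac12)\,\Gamma(n+2\alpha+1)}\,(1-\tau_j)\,\bigl(G_n^{(\alpha)}(\tau_j)\bigr)^{-2},\quad j=0,\dots,n.$$ The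 barycentric weights of the nodes are defined by $\xi_i=1/\prod_{j\neq i}(\tau_j-\tau_i)$, $i=0,\dots,n$, the product being over $j\in\{0,\dots,n\}\setminus\{i\}$. They are used in the barycentric formula $\mathcal{L}_{n,i}(\tau)=\frac{\xi_i}{\tau-\tau_i}\big/\sum_{j=0}^n\frac{\xi_j}{\tau-\tau_j}$ for the Lagrange basis polynomials.
   Formalization: The first equality is false as written (α=0, n=1: ξ_1=-2/3, right side √(π/3); the sign is always opposite). It is proved up to one nonzero factor c, independent of i and not given explicitly: ξ_i = c times the closed form for i=1,…,n. The second equality is exact. *)

(* Defs.v *)
From HB Require Import structures.
From mathcomp Require Import all_boot all_order all_algebra.
From mathcomp Require Import all_classical all_reals all_analysis.

Set Implicit Arguments.
Unset Strict Implicit.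
Unset Printing Implicit Defensive.

Import Order.TTheory GRing.Theory Num.Theory.
Import numFieldNormedType.Exports.

Local Open Scope classical_set_scope.
Local Open Scope ring_scope.

(* Euler's integral; meaningful for 0 < x only (a divergent integral has
   value 0 here, as [fine +oo = 0]). *)
Definition Gamma (R : realType) (x : R) : R :=
  \int[lebesgue_measure]_(t in `]0, +oo[) (t `^ (x - 1) * expR (- t)).

(* When alpha < 1/2 the weight is singular at -1 and 1, where [powR] makes it 0;
   two points do not affect the integral. *)
Definition gegenbauer_dot (R : realType) (alpha : R) (p q : {poly R}) : R :=
  \int[lebesgue_measure]_(t in `[-1, 1])
    (p.[t] * q.[t] * (1 - t ^+ 2) `^ (alpha - 2^-1)).

(* For -1/2 < alpha this determines [G k] uniquely for every k. *)
Definition gegenbauer_family (R : realType) (alpha : R) (G : nat -> {poly R}) :=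
  [/\ forall k, size (G k) = k.+1,
      forall j k, j != k -> gegenbauer_dot alpha (G j) (G k) = 0
    & forall k, (G k).[1] = 1].

Definition ggr_points (R : realType) (G : nat -> {poly R}) (n : nat)
    (tau : 'I_n.+1 -> R) :=
  [/\ tau ord0 = -1,
      forall i j : 'I_n.+1, (i < j)%N -> tau i < tau j
    & forall x, root (G n + G n.+1) x <-> exists i, tau i = x].

Definition ggr_theta (R : realType) (alpha : R) (G : nat -> {poly R}) (n : nat)
    (tau : 'I_n.+1 -> R) (j : 'I_n.+1) : R :=
  2 `^ (2 * alpha - 1) *
  (Gamma (alpha + 2^-1) ^+ 2 * n`!%:R /
     ((n%:R + alpha + 2^-1) * Gamma (n%:R + 2 * alpha + 1))) *
  (1 - tau j) * (G n).[tau j] ^- 2.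

Definition ggr_christoffel (R : realType) (alpha : R) (G : nat -> {poly R})
    (n : nat) (tau : 'I_n.+1 -> R) (j : 'I_n.+1) : R :=
  if j == ord0 then (alpha + 2^-1) * ggr_theta alpha G tau j
  else ggr_theta alpha G tau j.

(* Barycentric weights enter the barycentric formula only through the quotient
   (xi_i / (t - tau_i)) / (\sum_j xi_j / (t - tau_j)), and so are understood up
   to a nonzero factor common to all nodes.  Closed forms in the Christoffel
   numbers need this reading: for alpha = 0 and n = 1 the nodes are -1 and 1/2,
   [bary_weight] at 1/2 is -2/3, but sin (acos (1/2) / 2) * sqrt (2 * varpi_1)
   is sqrt (pi / 3). *)
Definition bary_weight (R : realType) (n : nat) (tau : 'I_n.+1 -> R)
    (i : 'I_n.+1) : R :=
  (\prod_(j < n.+1 | j != i) (tau j - tau i))^-1.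

(* Main.v *)
Require Import Defs.
From HB Require Import structures.
From mathcomp Require Import all_boot all_order all_algebra.
From mathcomp Require Import all_classical all_reals all_analysis.
From mathcomp Require Import measurable_realfun zify ring lra.
Import Order.TTheory GRing.Theory Num.Theory.
Import numFieldNormedType.Exports.
Local Open Scope classical_set_scope.
Local Open Scope ring_scope.

(** Let [P = G n + G n.+1] and let [k] be its leading coefficient.  Since the
    nodes are the roots of [P], the product of the [tau i - tau j] over
    [j != i] is [P'(tau i) / k], and since the nodes increase, the product of
    the [tau j - tau i] has the sign [(-1) ^+ i].  As
    [sin (acos t / 2) = sqrt ((1 - t) / 2)] and
    [varpi = K * (1 - tau i) / G_n(tau i) ^ 2] with a constant [K > 0], the
    theorem says that [(1 - tau i) * P'(tau i)] and [G_n(tau i)] have a ratio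
    which is nonzero and has an absolute value independent of [i].

    Write [P = (1 + 'X) * J]; the interior nodes are the roots of [J], and at
    them [(1 - t) * P' = (1 - t ^ 2) * J'].  For the weight
    [W = (1 - t ^ 2) `^ (alpha - 1 / 2)], [(1 + 'X) * J] is orthogonal to all
    polynomials of degree less than [n].  Both [G n] and, by an integration by
    parts, [(1 - 'X^2) * J'] are orthogonal to [(1 + 'X) * r] whenever
    [deg r < n - 1], and this survives reduction modulo [J].  Among the
    polynomials of degree less than [n], those with this orthogonality form a
    line: such a polynomial [U] with [U(-1) = 0] is itself of the form
    [(1 + 'X) * r], hence orthogonal to itself ([radau_perp_eq0]).  So the two
    remainders are proportional, and evaluating them at the roots of [J] gives
    [(1 - t ^ 2) * J' = A * G_n] there with one constant [A]
    ([radau_deriv_at_roots]).  It is nonzero: the roots of [J] are simple, and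
    [J] does not divide [G n] ([gegenbauer_modp_neq0]).  The weights being
    compared up to a common factor, nothing more about [A] is needed.

    The analysis needed is that the weight is integrable although it may be
    singular at both endpoints, that the boundary terms vanish in the
    integration by parts, that a nonnegative polynomial with zero integral is
    zero, and that [Gamma] is finite and positive on positive reals (this gives
    [K > 0]).  The two integrability facts rest on one principle: a nonnegative
    continuous function with a bounded primitive is integrable
    ([integrable_bounded_primitive]). *)

(** * Integration over an increasing union of segments *)

(** The truncations of [f] to the [E n] are dominated by the absolute value of
    [f]; monotone convergence would not cover an [f] that changes sign. *)
Lemma cvg_integral_bigcup d (T : measurableType d) (R : realType)
    (mu : {measure set T -> \bar R}) (E : (set T)^nat) (f : T -> R) :
  nondecreasing_seq E -> (forall n, measurable (E n)) ->
  mu.-integrable (\bigcup_n E n) (EFin \o f) ->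
  (\int[mu]_(x in E n) (f x)%:E @[n --> \oo] -->
   \int[mu]_(x in \bigcup_n E n) (f x)%:E)%E.
Proof.
move=> ndE mE fi.
set D := \bigcup_n E n in fi *.
have mD : measurable D by exact: bigcup_measurable.
have ED n : E n `<=` D by move=> x Ex; exists n.
have mf : measurable_fun D f by apply/measurable_EFinP; exact: measurable_int fi.
have [|||||_ _] := @dominated_convergence _ _ _ mu D mD
   (fun n => EFin \o (f \_ (E n))) (EFin \o f) (fun x => `|(f x)%:E|%E).
- move=> n; apply/measurable_EFinP/(measurable_restrict f (mE n) mD).
  by apply: measurable_funS mf => //; apply: subIset; left.
- exact/measurable_EFinP.
- apply: aeW => x [n _ Enx].
  apply: cvg_near_cst; exists n => // m /= nm.
  rewrite patchE mem_set//.
  by have /subsetPset := ndE _ _ nm; exact.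
- exact: integrable_abse.
- apply: aeW => x n Dx /=; rewrite lee_fin patchE; case: ifPn => //= _.
  by rewrite normr0.
have -> // : (fun n => \int[mu]_(x in D) (EFin \o (f \_ (E n))) x)%E =
  (fun n => \int[mu]_(x in E n) (f x)%:E)%E.
by apply/funext => n; rewrite -restrict_EFin -integral_mkcondr setIidr.
Qed.

Section exhaustion.
Context {R : realType}.
Notation mu := (@lebesgue_measure R).
Context (u v : R^nat) (f F : R -> R) (D : set R)
  (uv : forall n, u n < v n)
  (nduv : nondecreasing_seq (fun n => `[u n, v n]%classic : set R))
  (uvD : \bigcup_n `[u n, v n]%classic = D)
  (cf : forall x, D x -> {for x, continuous f})
  (dF : forall x, D x -> is_derive x 1 F (f x)).

Let segD n x : u n <= x <= v n -> D x.
Proof. by move=> h; rewrite -uvD; exists n => //=; rewrite in_itv. Qed.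

Lemma integral_segment_primitive n :
  (\int[mu]_(x in `[u n, v n]) (f x)%:E = (F (v n) - F (u n))%:E)%E.
Proof.
have cF x : D x -> {for x, continuous F}.
  by move=> Dx; apply/differentiable_continuous/derivable1_diffP; case: (dF _ Dx).
have Du : D (u n) by apply: (@segD n); rewrite lexx ltW.
have Dv : D (v n) by apply: (@segD n); rewrite lexx ltW.
rewrite (@continuous_FTC2 _ f F)//.
- apply: continuous_in_subspaceT => x; rewrite inE/= in_itv/= => /segD.
  exact: cf.
- split.
  + move=> x; rewrite in_itv/= => /andP[ux xv].
    have /dF[//] : D x by apply: (@segD n); rewrite !ltW.
  + by apply: cvg_at_right_filter; exact: cF.
  + by apply: cvg_at_left_filter; exact: cF.
- move=> x; rewrite in_itv/= => /andP[ux xv].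
  rewrite derive1E.
  have /dF[//] : D x by apply: (@segD n); rewrite !ltW.
Qed.

Let mseg n : measurable (`[u n, v n]%classic : set R). Proof. exact: measurable_itv. Qed.

Lemma measurable_bigcup_segment : measurable D.
Proof. by rewrite -uvD; exact: bigcup_measurable. Qed.

Lemma measurable_fun_bigcup_segment : measurable_fun D f.
Proof.
rewrite -uvD; apply/(measurable_fun_bigcup _) => // n.
apply: subspace_continuous_measurable_fun => //.
apply: continuous_in_subspaceT => x; rewrite inE/= in_itv/= => /segD.
exact: cf.
Qed.

(** By monotone convergence the integral is the limit of the increments
    [F (v n) - F (u n)], all at most [2 * M]. *)
Lemma integrable_bounded_primitive (M : R) :
  (forall x, D x -> 0 <= f x) -> (forall x, D x -> `|F x| <= M) ->
  mu.-integrable D (EFin \o f).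
Proof.
move=> f0 FM; apply/integrableP; split.
  by apply/measurable_EFinP; exact: measurable_fun_bigcup_segment.
have : (\int[mu]_(x in `[u n, v n]) `|(f x)%:E| @[n --> \oo] -->
   \int[mu]_(x in \bigcup_n `[u n, v n]%classic) `|(f x)%:E|)%E.
  apply: ge0_nondecreasing_set_cvg_integral => // n.
  apply: measurableT_comp => //; apply/measurable_EFinP.
  apply: measurable_funS measurable_fun_bigcup_segment.
    exact: measurable_bigcup_segment.
  by move=> x; rewrite /= in_itv/= => /segD.
rewrite uvD => h.
apply: (@le_lt_trans _ _ (M + M)%:E); last by rewrite ltry.
rewrite -(cvg_lim _ h)//.
apply: lime_le.
  by apply/cvg_ex; eexists; exact: h.
apply: nearW => n.
rewrite [leLHS](_ : _ = \int[mu]_(x in `[u n, v n]) (f x)%:E)%E; last first.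
  apply: eq_integral => x; rewrite inE/= in_itv/= => /segD Dx.
  by rewrite ger0_norm ?f0.
rewrite integral_segment_primitive lee_fin.
apply: (le_trans (ler_norm _)); apply: (le_trans (ler_normB _ _)).
by apply: lerD; apply: FM; apply: (@segD n); rewrite lexx ltW.
Qed.

(** The fundamental theorem of calculus in a form that asks nothing of [f] and
    [F] at the endpoints of [D], where [f] may be unbounded. *)
Lemma Rintegral_primitive (l : R) : mu.-integrable D (EFin \o f) ->
  F (v n) - F (u n) @[n --> \oo] --> l ->
  \int[mu]_(x in D) f x = l.
Proof.
move=> fi Fl.
have := cvg_integral_bigcup _ _ _ mu _ f nduv mseg.
rewrite uvD => /(_ fi).
under eq_fun do rewrite integral_segment_primitive.
move=> h; rewrite /Rintegral -(cvg_lim _ h)//.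
by have /cvg_lim -> : (F (v n) - F (u n))%:E @[n --> \oo] --> l%:E
  by apply/cvg_EFin; [exact: nearW|exact: Fl].
Qed.

End exhaustion.

(** Otherwise [f] would vanish almost everywhere on [D], hence [E] would be
    negligible. *)
Lemma Rintegral_gt0 d (T : measurableType d) (R : realType)
    (mu : {measure set T -> \bar R}) (D E : set T) (f : T -> R) :
  measurable D -> measurable E -> E `<=` D -> mu E != 0%E ->
  mu.-integrable D (EFin \o f) -> (forall x, D x -> 0 <= f x) ->
  (forall x, E x -> 0 < f x) -> 0 < \int[mu]_(x in D) f x.
Proof.
move=> mD mE ED muE fi f0 fgt0.
rewrite lt0r Rintegral_ge0// andbT; apply/negP => /eqP I0.
move: muE; apply/negP; rewrite negbK; apply/eqP.
have [N [mN muN subN]] : ae_eq mu D (EFin \o f) (cst 0%E).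
  apply/ae_eq_integral_abs => //; first exact: measurable_int fi.
  rewrite [LHS](_ : _ = \int[mu]_(x in D) (f x)%:E)%E; last first.
    by apply: eq_integral => x; rewrite inE => Dx /=; rewrite ger0_norm ?f0.
  by rewrite -[LHS]fineK ?integrable_fin_num// -/(Rintegral mu D f) I0.
apply: (subset_measure0 mE mN _ muN) => x Ex; apply: subN => /= h.
by have := fgt0 x Ex; have [->] := h (ED x Ex); rewrite ltxx.
Qed.

Lemma continuous_powR_gt0 (R : realType) (a x : R) : 0 < x ->
  {for x, continuous (@powR R ^~ a)}.
Proof.
move=> x0; apply/differentiable_continuous/derivable1_diffP.
by have [] := @is_derive1_powR R a x x0.
Qed.

(** * Euler's integral *)

Section Gamma_gt0.
Context {R : realType}.
Notation mu := (@lebesgue_measure R).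

Let u (n : nat) : R := n.+2%:R^-1.
Let v (n : nat) : R := n.+1%:R.

Let uv n : u n < v n.
Proof.
apply: (@lt_le_trans _ _ 1); first by rewrite invf_lt1 ?ltr0n// ltr1n.
by rewrite ler1n.
Qed.

Let nduv : nondecreasing_seq (fun n => `[u n, v n]%classic : set R).
Proof.
move=> m n mn; apply/subsetPset; apply: subset_itv; rewrite bnd_simp.
  by rewrite lef_pV2 ?posrE ?ltr0n// ler_nat.
by rewrite ler_nat.
Qed.

Let bigcup_uv : \bigcup_n `[u n, v n]%classic = `]0, +oo[%classic :> set R.
Proof.
apply/seteqP; split => x /=.
  move=> [n _ /=]; rewrite !in_itv/= andbT => /andP[h _].
  by apply: lt_le_trans h; rewrite invr_gt0 ltr0n.
rewrite in_itv/= andbT => x0.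
pose n := Num.trunc (Num.max x x^-1).
have : Num.max x x^-1 < n.+1%:R by exact: truncnS_gt.
rewrite gt_max => /andP[xn nx].
exists n => //=; rewrite in_itv/= (ltW xn) andbT /u.
rewrite -[leRHS]invrK lef_pV2 ?posrE ?invr_gt0 ?ltr0n//.
by apply: (le_trans (ltW nx)); rewrite ler_nat.
Qed.

(** The derivative in [t] of the bounded function [(t / (1 + t)) `^ x]; like the
    integrand of [Gamma x] it behaves as [t `^ (x - 1)] near 0, and it decays
    only polynomially at infinity. *)
Let h (x t : R) := x * (t / (1 + t)) `^ (x - 1) * ((1 + t)^-1 ^+ 2).

Let ratio_gt0 (t : R) : 0 < t -> 0 < t / (1 + t).
Proof. by move=> t0; rewrite divr_gt0// addr_gt0. Qed.

Let dratio (t : R) : 0 < t ->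
  is_derive t 1 (fun t : R => t / (1 + t)) ((1 + t)^-1 ^+ 2).
Proof.
move=> t0.
have t1 : 1 + t != 0 by rewrite gt_eqF// addr_gt0.
have d1 : is_derive t 1 (fun t : R => 1 + t) 1.
  have h1 : is_derive t (1 : R) ((cst 1 : R -> R) + id) (0 + 1) by exact: is_deriveD.
  by rewrite add0r in h1.
have h1 := is_deriveV t1 d1.
have h2 : is_derive t (1 : R) (id * (fun t : R => (1 + t)^-1))
   (t *: (- (1 + t) ^- 2 *: 1) + (1 + t)^-1 *: 1) by exact: is_deriveM.
apply: (trigger_derive h2).
by rewrite /GRing.scale/=; field.
Qed.

Let dH (x t : R) : 0 < t ->
  is_derive t 1 ((@powR R ^~ x) \o (fun t : R => t / (1 + t))) (h x t).
Proof.
move=> t0; have t1 := ratio_gt0 _ t0.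
exact: (@is_derive1_comp R (@powR R ^~ x) (fun t : R => t / (1 + t)) _ _ _
  (is_derive1_powR x t1) (dratio _ t0)).
Qed.

Let integrable_h (x : R) : 0 < x -> mu.-integrable `]0, +oo[ (EFin \o h x).
Proof.
move=> x0.
apply: (integrable_bounded_primitive _ _ _ _ _ uv nduv bigcup_uv _ _ 1).
- move=> t; rewrite /= in_itv/= andbT => t0.
  have cr : {for t, continuous (fun t : R => t / (1 + t))}.
    apply/differentiable_continuous/derivable1_diffP.
    by have [] := dratio _ t0.
  have t1 : 1 + t != 0 by rewrite gt_eqF// addr_gt0.
  apply: continuousM.
    apply: continuousM; first exact: cst_continuous.
    apply: (@continuous_comp _ _ _ (fun t : R => t / (1 + t)) (@powR R ^~ (x - 1))) => //.
    by apply: continuous_powR_gt0; exact: ratio_gt0.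
  have ci : {for t, continuous (fun t : R => (1 + t)^-1)}.
    apply: continuousV => //; apply: continuousD; first exact: cst_continuous.
    exact: cvg_id.
  by apply: continuousM; exact: ci.
- move=> t; rewrite /= in_itv/= andbT => t0; exact: dH.
- by move=> t _; rewrite /h mulr_ge0 ?sqr_ge0// mulr_ge0 ?powR_ge0// ltW.
- move=> t; rewrite /= in_itv/= andbT => t0.
  rewrite ger0_norm ?powR_ge0//.
  have E1 : 1 = 1 `^ x :> R by rewrite powR1.
  rewrite [leRHS]E1.
  rewrite ge0_ler_powR ?nnegrE ?(ltW x0) ?(ltW (ratio_gt0 _ t0))//.
  by rewrite ler_pdivrMr ?addr_gt0// mul1r lerDr.
Qed.

(** This is the inequality [y / p <= expR (y / p)] raised to the power [p]. *)
Let powR_expR_bound (p y : R) : 0 < p -> 0 < y -> y `^ p <= p `^ p * expR y.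
Proof.
move=> p0 y0.
have -> : expR y = (expR (y / p)) `^ p.
  by rewrite -expRM divfK// gt_eqF.
rewrite -powRM ?expR_ge0 ?(ltW p0)//.
rewrite ge0_ler_powR ?nnegrE ?(ltW p0) ?(ltW y0)//.
  by rewrite mulr_ge0 ?expR_ge0// ltW.
rewrite -ler_pdivrMl// mulrC.
apply: le_trans (expR_ge1Dx (y / p)).
by rewrite lerDr.
Qed.

(** The integrand is at most a constant times [h x]: their ratio is
    [(1 + t) `^ (x + 1) * expR (- t) / x], to which [powR_expR_bound] applies. *)
Lemma integrable_Gamma (x : R) : 0 < x ->
  mu.-integrable `]0, +oo[ (EFin \o (fun t => t `^ (x - 1) * expR (- t))).
Proof.
move=> x0.
pose C := (x + 1) `^ (x + 1) * expR 1 / x.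
have ih : mu.-integrable `]0, +oo[ (EFin \o (fun t => C * h x t)).
  by have := integrableZl _ C (integrable_h x x0); apply; exact: measurable_itv.
apply: le_integrable ih => //.
  apply/measurable_EFinP/measurable_funM.
    by apply: measurable_funTS; exact: measurable_powR.
  apply: measurable_funTS; apply: measurableT_comp => //.
move=> t; rewrite /= in_itv/= andbT => t0.
have t1 : 0 < 1 + t by rewrite addr_gt0.
rewrite lee_fin ger0_norm; last by rewrite mulr_ge0 ?powR_ge0 ?expR_ge0.
apply: le_trans (ler_norm _).
rewrite /h /C.
have -> : t `^ (x - 1) = (t / (1 + t)) `^ (x - 1) * (1 + t) `^ (x - 1).
  by rewrite -(powRM _ (ltW (ratio_gt0 _ t0)) (ltW t1)) divfK// gt_eqF.
have -> : (1 + t) `^ (x - 1) = (1 + t) `^ (x + 1) * (1 + t)^-1 ^+ 2.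
  rewrite exprVn -powR_invn ?ltW// -powRD; last first.
    by apply/implyP => _; rewrite gt_eqF.
  by congr (_ `^ _); lra.
set A := (t / (1 + t)) `^ (x - 1); set B := (1 + t)^-1 ^+ 2.
have A0 : 0 <= A by exact: powR_ge0.
have B0 : 0 <= B by exact: sqr_ge0.
have -> : (x + 1) `^ (x + 1) * expR 1 / x * (x * A * B) =
    A * (((x + 1) `^ (x + 1) * expR 1) * B) by field; rewrite gt_eqF.
rewrite -mulrA ler_wpM2l// mulrAC ler_wpM2r//.
rewrite expRN ler_pdivrMr ?expR_gt0// -mulrA -expRD.
by apply: powR_expR_bound => //; rewrite addr_gt0.
Qed.

Lemma Gamma_gt0 (x : R) : 0 < x -> 0 < Gamma x.
Proof.
move=> x0; rewrite /Gamma.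
have := Rintegral_gt0 _ _ _ mu `]0, +oo[%classic `]0, +oo[%classic
  (fun t => t `^ (x - 1) * expR (- t)).
apply => //.
- have : mu `]0%R, +oo[%classic != 0%E by rewrite lebesgue_measure_itv /= ltry.
  exact.
- exact: integrable_Gamma.
- by move=> t _; rewrite mulr_ge0 ?powR_ge0 ?expR_ge0.
- by move=> t; rewrite /= in_itv/= andbT => t0; rewrite mulr_gt0 ?powR_gt0 ?expR_gt0.
Qed.

End Gamma_gt0.

Lemma exists_roots_seq (R : idomainType) (p : {poly R}) : p != 0 ->
  exists s : seq R, forall t, root p t -> t \in s.
Proof.
have [n] := ubnP (size p); elim: n p => // n IH p pn pN0.
have [[a /factor_theorem[q pE]]|noroot] := pselect (exists a, root p a); last first.
  by exists [::] => t pt; exfalso; apply: noroot; exists t.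
have qN0 : q != 0 by apply: contraNneq pN0 => q0; rewrite pE q0 mul0r.
have [|//|s sq] := IH q.
  by move: pn; rewrite pE size_Mmonic ?monicXsubC// size_XsubC addn2.
exists (a :: s) => t; rewrite pE rootM root_XsubC inE => /orP[/sq ->|->] //.
by rewrite orbT.
Qed.

(** * The Gegenbauer weight *)

Section gegenbauer_weight.
Context {R : realType} (alpha : R) (halpha : - 2^-1 < alpha).
Notation mu := (@lebesgue_measure R).

Let W (t : R) := (1 - t ^+ 2) `^ (alpha - 2^-1).
Let V (t : R) := (1 - t ^+ 2) `^ (alpha + 2^-1).
Let I11 : set R := `]-1, 1[%classic.

Let e (n : nat) : R := n.+2%:R^-1.
Let u (n : nat) : R := -1 + e n.
Let v (n : nat) : R := 1 - e n.

Let e_bounds n : 0 < e n <= 2^-1.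
Proof. by rewrite invr_gt0 ltr0n lef_pV2 ?posrE ?ltr0n// ler_nat. Qed.

Let uv n : u n < v n.
Proof. by rewrite /u /v; have /andP[e0 e1] := e_bounds n; lra. Qed.

Let nduv : nondecreasing_seq (fun n => `[u n, v n]%classic : set R).
Proof.
move=> m n mn; apply/subsetPset.
have h : e n <= e m.
  by rewrite lef_pV2 ?posrE ?ltr0n// ler_nat.
by apply: subset_itv; rewrite bnd_simp /u /v; lra.
Qed.

Let bigcup_uv : \bigcup_n `[u n, v n]%classic = I11.
Proof.
apply/seteqP; split => x /=.
  move=> [n _ /=]; rewrite /I11/= !in_itv/= /u /v.
  by have /andP[e0 e1] := e_bounds n; move=> /andP[h1 h2]; apply/andP; split; lra.
rewrite /I11/= in_itv/= => /andP[x1 x2].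
pose n := Num.trunc (Num.max (1 + x)^-1 (1 - x)^-1).
have : Num.max (1 + x)^-1 (1 - x)^-1 < n.+1%:R by exact: truncnS_gt.
have nn : n.+1%:R <= n.+2%:R :> R by rewrite ler_nat.
rewrite gt_max => /andP[xn nx].
have h1 : e n <= 1 + x.
  rewrite -[leRHS]invrK lef_pV2 ?posrE ?invr_gt0 ?ltr0n//; lra.
have h2 : e n <= 1 - x.
  rewrite -[leRHS]invrK lef_pV2 ?posrE ?invr_gt0 ?ltr0n//; lra.
by exists n => //=; rewrite in_itv/= /u /v; apply/andP; split; lra.
Qed.

Let sqr_lt1 t : I11 t -> 0 < 1 - t ^+ 2.
Proof.
rewrite /I11/= in_itv/= => /andP[h1 h2].
have -> : 1 - t ^+ 2 = (1 - t) * (1 + t) by ring.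
by rewrite mulr_gt0//; lra.
Qed.

Let VE t : I11 t -> V t = (1 - t ^+ 2) * W t.
Proof.
move=> /sqr_lt1 t1; rewrite /V /W.
have -> : alpha + 2^-1 = 1 + (alpha - 2^-1) by lra.
rewrite [LHS]powRD; last by apply/implyP => _; rewrite gt_eqF.
by rewrite powRr1 ?ltW.
Qed.

Let W_gt0 t : I11 t -> 0 < W t.
Proof. by move=> /sqr_lt1 t1; exact: powR_gt0. Qed.

Let is_derive_horner (p : {poly R}) (t : R) :
  is_derive t 1 (horner p) p^`().[t].
Proof. by split; [exact: derivable_horner|rewrite derivE derive1E]. Qed.

Let wE : (fun t : R => 1 - t ^+ 2) = horner (1 - 'X^2).
Proof. by apply/funext => t; rewrite !hornerE. Qed.

(** Up to sign the adjoint of [p |-> (1 - 'X^2) * p^`()] for the Gegenbauer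
    weight: the derivative of [p.[t] * (1 - t ^+ 2) `^ (alpha + 2^-1)] is this
    polynomial times [(1 - t ^+ 2) `^ (alpha - 2^-1)]. *)
Definition gegenbauer_adjoint (p : {poly R}) : {poly R} :=
  (1 - 'X^2) * p^`() - (2 * alpha + 1) *: ('X * p).

Let dV (p : {poly R}) t : I11 t ->
  is_derive t 1 (fun t => p.[t] * V t) ((gegenbauer_adjoint p).[t] * W t).
Proof.
move=> It; have t1 := sqr_lt1 _ It.
have d1 := is_derive_horner (1 - 'X^2) t.
have d2 : is_derive t 1 V ((alpha + 2^-1) * (1 - t ^+ 2) `^ (alpha + 2^-1 - 1)
     * (1 - 'X^2 : {poly R})^`().[t]).
  have hp := is_derive1_powR (alpha + 2^-1) t1.
  have e1 : 1 - t ^+ 2 = (1 - 'X^2).[t] by rewrite !hornerE.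
  rewrite {1}e1 in hp.
  have := @is_derive1_comp R (@powR R ^~ (alpha + 2^-1)) (horner (1 - 'X^2)) _ _ _ hp d1.
  by rewrite -wE.
have h : is_derive t (1 : R) (horner p * V)
  (p.[t] *: ((alpha + 2^-1) * (1 - t ^+ 2) `^ (alpha + 2^-1 - 1)
     * (1 - 'X^2 : {poly R})^`().[t]) + V t *: p^`().[t]).
  by have := is_deriveM (is_derive_horner p t) d2.
apply: (trigger_derive h).
rewrite VE// /W.
have -> : alpha + 2^-1 - 1 = alpha - 2^-1 by lra.
rewrite /GRing.scale/= /gegenbauer_adjoint.
have -> : (1 - 'X^2 : {poly R})^`() = - ('X *+ 2).
  by rewrite derivB derivXn -polyC1 derivC sub0r.
have e1 : (1 - 'X^2 : {poly R}).[t] = 1 - t ^+ 2 by rewrite !hornerE.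
move: (1 - 'X^2 : {poly R}) e1 => q e1.
rewrite !(hornerD, hornerN, hornerZ, hornerM, hornerMn, hornerX) e1.
by field.
Qed.

Let measurable_W : measurable_fun I11 W.
Proof.
apply: measurable_funTS; apply: (measurableT_comp (measurable_powR _)).
by rewrite wE; apply: continuous_measurable_fun; exact: continuous_horner.
Qed.

Let continuous_W t : I11 t -> {for t, continuous W}.
Proof.
move=> It; apply: (@continuous_comp _ _ _ (fun t : R => 1 - t ^+ 2) (@powR R ^~ (alpha - 2^-1))).
  by rewrite wE; exact: continuous_horner.
by apply: continuous_powR_gt0; exact: sqr_lt1.
Qed.

Let mI11 : measurable (I11 : set (measurableTypeR R)).
Proof. exact: measurable_itv. Qed.

Let V_le1 t : I11 t -> 0 <= V t <= 1.
Proof.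
move=> It; have t1 := sqr_lt1 _ It; rewrite powR_ge0/=.
have E1 : 1 = 1 `^ (alpha + 2^-1) :> R by rewrite powR1.
rewrite [leRHS]E1 ge0_ler_powR ?nnegrE ?(ltW t1)//; first by move: halpha; lra.
by rewrite gerBl sqr_ge0.
Qed.

(** Rather than comparing [W] with a different singular function at each
    endpoint, use the bounded function [t - t * V t].  Its derivative [f] is
    [1 - V + (2 * alpha + 1) * t ^ 2 * W], which is nonnegative because [V <= 1],
    and [W = t ^ 2 * W + V] is at most a multiple of [f] plus a constant. *)
Lemma integrable_weight : mu.-integrable I11 (EFin \o W).
Proof.
pose f t := 1 + (gegenbauer_adjoint (- 'X)).[t] * W t.
have fE t : I11 t -> f t = 1 - V t + (2 * alpha + 1) * (t ^+ 2 * W t).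
  move=> It; rewrite VE// /f /gegenbauer_adjoint derivN derivX -polyC1.
  by rewrite !(hornerD, hornerN, hornerZ, hornerM, hornerX, hornerXn, hornerC); ring.
have al : 0 < 2 * alpha + 1 by move: halpha; lra.
have intf : mu.-integrable I11 (EFin \o f).
  apply: (integrable_bounded_primitive _ _ f
     (id + (fun t => (- 'X : {poly R}).[t] * V t)) _ uv nduv bigcup_uv _ _ 2).
  - move=> t It; apply: continuousD; first exact: cst_continuous.
    by apply: continuousM; [exact: continuous_horner|exact: continuous_W].
  - by move=> t It; apply: is_deriveD; exact: dV.
  - move=> t It; rewrite fE//.
    have /andP[_ V1] := V_le1 _ It.
    rewrite addr_ge0 ?subr_ge0// mulr_ge0 ?(ltW al)//.
    by rewrite mulr_ge0 ?sqr_ge0// ltW// W_gt0.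
  - move=> t It; have /andP[V0 V1] := V_le1 _ It.
    rewrite /= fctE !hornerE.
    have : `|t| <= 1.
      by move: It; rewrite /I11/= in_itv/= ler_norml => /andP[? ?]; rewrite !ltW.
    move=> t1; apply: (le_trans (ler_normD _ _)).
    rewrite normrM normrN (ger0_norm V0).
    have : `|t| * V t <= 1 by rewrite mulr_ile1.
    lra.
have ig : mu.-integrable I11
    (EFin \o (fun t => (2 * alpha + 1)^-1 * (f t + (2 * alpha + 2)))).
  have ik : mu.-integrable I11 (EFin \o cst (2 * alpha + 2)).
    apply: measurable_bounded_integrable => //.
      have : (mu `](-1)%R, 1%R[%classic < +oo)%E.
        by rewrite lebesgue_measure_itv /= lte_fin; case: ifP => // _; rewrite ltry.
      exact.
    by exists (`|2 * alpha + 2|); split => // M hM t _; exact: ltW.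
  have ic : mu.-integrable I11 (EFin \o (fun t => f t + (2 * alpha + 2))).
    by have := integrableD mI11 intf ik.
  by have := integrableZl mI11 (2 * alpha + 1)^-1 ic.
apply: le_integrable ig => //; first exact/measurable_EFinP.
move=> t It; rewrite lee_fin gtr0_norm ?W_gt0//.
apply: le_trans (ler_norm _).
rewrite ler_pdivlMl// fE//.
have /andP[V0 V1] := V_le1 _ It.
have EV := VE _ It.
have : (2 * alpha + 1) * V t <= 2 * alpha + 1 by rewrite ger_pMr.
have -> : (2 * alpha + 1) * W t = (2 * alpha + 1) * V t + (2 * alpha + 1) * (t ^+ 2 * W t).
  by rewrite EV; ring.
lra.
Qed.

(** The open interval avoids the endpoints, where the weight need not be positive
    or continuous. *)
Definition gegenbauer_int (p : {poly R}) : R :=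
  \int[mu]_(t in `]-1, 1[) (p.[t] * (1 - t ^+ 2) `^ (alpha - 2^-1)).

Lemma integrable_horner_weight (p : {poly R}) :
  mu.-integrable I11 (EFin \o (fun t => p.[t] * W t)).
Proof.
have := integrableMr mI11 _ _ integrable_weight; apply.
  by apply: measurable_funTS; apply: continuous_measurable_fun; exact: continuous_horner.
have [C hC] : exists C, forall t, I11 t -> `|p.[t]| <= C.
  elim/poly_ind: p => [|p c [C hC]]; first by exists 0 => t _; rewrite horner0 normr0.
  exists (C + `|c|) => t It; rewrite !hornerE.
  apply: (le_trans (ler_normD _ _)); rewrite lerD2r normrM.
  apply: (le_trans _ (hC t It)); rewrite ler_piMr//.
  by move: It; rewrite /I11/= in_itv/= ler_norml => /andP[? ?]; rewrite !ltW.
exists C; split; first exact: num_real.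
by move=> M CM t It; exact: (le_trans (hC t It) (ltW CM)).
Qed.

Lemma gegenbauer_intD p q :
  gegenbauer_int (p + q) = gegenbauer_int p + gegenbauer_int q.
Proof.
rewrite -[RHS](@RintegralD _ _ _ mu)//; try exact: integrable_horner_weight.
by apply: eq_Rintegral => t _; rewrite hornerD mulrDl.
Qed.

Lemma gegenbauer_intZ c p : gegenbauer_int (c *: p) = c * gegenbauer_int p.
Proof.
rewrite -[RHS](@RintegralZl _ _ _ mu)//; try exact: integrable_horner_weight.
by apply: eq_Rintegral => t _; rewrite hornerZ mulrA.
Qed.

Lemma gegenbauer_dotE p q : gegenbauer_dot alpha p q = gegenbauer_int (p * q).
Proof.
rewrite /gegenbauer_dot /gegenbauer_int /Rintegral.
rewrite integral_itv_bndoo.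
  by congr fine; apply: eq_integral => t _; rewrite hornerM.
apply/measurable_EFinP/measurable_funM => //.
apply: measurable_funM; apply: measurable_funTS; apply: continuous_measurable_fun;
  exact: continuous_horner.
Qed.

Let cvg_v : v n @[n --> \oo] --> (1 : R).
Proof.
rewrite -[X in _ --> X]subr0; apply: cvgB; first exact: cvg_cst.
have := @cvg_harmonic R; rewrite -(cvg_shiftS (@harmonic R)); exact.
Qed.

Let cvg_V_end : V (v n) @[n --> \oo] --> (0 : R).
Proof.
have al : 0 < alpha + 2^-1 by move: halpha; lra.
have /cvg_at_rightP := powR_cvg0 al; apply; split.
  by move=> n; rewrite sqr_lt1// -bigcup_uv; exists n => //=; rewrite in_itv/= lexx ltW.
have : (1 - v n ^+ 2) @[n --> \oo] --> (1 - 1 ^+ 2 : R).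
  by apply: cvgB; [exact: cvg_cst|apply: cvgM; exact: cvg_v].
by rewrite expr1n subrr.
Qed.

(** The integrand is the derivative of [p.[t] * V t], and [V] vanishes at both
    endpoints because [alpha + 2^-1] is positive. *)
Lemma gegenbauer_int_adjoint p : gegenbauer_int (gegenbauer_adjoint p) = 0.
Proof.
apply: (Rintegral_primitive _ _ _ (fun t => p.[t] * V t) _ uv nduv bigcup_uv).
- move=> t It; apply: continuousM; [exact: continuous_horner|exact: continuous_W].
- by move=> t It; exact: dV.
- exact: integrable_horner_weight.
- (* As [V] is even, the lower boundary term is the upper one of [p \Po (- 'X)]. *)
  have uN n : u n = - v n by rewrite /u /v; lra.
  have VN n : V (u n) = V (v n) by rewrite uN /V sqrrN.
  have hp (q : {poly R}) : q.[v n] * V (v n) @[n --> \oo] --> (0 : R).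
    rewrite -(mulr0 q.[1]); apply: cvgM cvg_V_end.
    by apply: (cvg_comp _ _ cvg_v); exact: continuous_horner.
  have hN n : p.[- v n] = (p \Po (- 'X)).[v n] by rewrite horner_comp !hornerE.
  have := cvgB (hp p) (hp (p \Po (- 'X))); rewrite subr0.
  have -> // : (fun n => p.[v n] * V (v n)) - (fun n => (p \Po (- 'X)).[v n] * V (v n))
     = (fun n => p.[v n] * V (v n) - p.[u n] * V (u n)).
  by apply/funext => n; rewrite VN uN hN.
  by apply; exact: eventually_filter.
Qed.

(** On the open interval the weight is positive and [p] has finitely many roots,
    so for [p != 0] the integrand is positive off a null set. *)
Lemma gegenbauer_int_eq0 p : (forall t, -1 < t < 1 -> 0 <= p.[t]) ->
  gegenbauer_int p = 0 -> p = 0.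
Proof.
move=> p0 Ip; apply/eqP; apply: contraPT Ip => pN0.
apply/eqP; rewrite gt_eqF//.
have W0 : forall t, I11 t -> 0 <= p.[t] * W t.
  move=> t It; apply: mulr_ge0; last exact/ltW/W_gt0.
  by apply: p0; move: It; rewrite /I11/= in_itv.
have cp : countable [set t : R | root p t].
  apply: finite_set_countable.
  have [s sp] := exists_roots_seq _ p pN0.
  by apply: sub_finite_set (finite_seq s) => t /sp.
have mZ : measurable ([set t : R | root p t] : set (measurableTypeR R)).
  by apply: countable_measurable cp => t; exact: measurable_set1.
pose E : set R := I11 `\` [set t | root p t].
have := Rintegral_gt0 _ _ _ mu I11 E (fun t => p.[t] * W t); apply => //.
- exact: measurableD.
- by move=> t [].
- suff : mu E != 0%E by exact.
  have : (mu I11 <= mu (E `|` [set t : R | root p t]))%E.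
    apply: le_measure; rewrite ?inE//.
      by apply: measurableU => //; exact: measurableD.
    by move=> t It; have [pt|pt] := boolP (root p t); [right|left; split => //; exact/negP].
  rewrite measureU0//; last 2 first.
  - exact: measurableD.
  - exact: countable_lebesgue_measure0.
  have -> : mu I11 = 2%:E.
    by rewrite /I11 lebesgue_measure_itv /= lte_fin ifT; [rewrite -EFinB; congr EFin; lra|lra].
  move=> h; apply/negP => /eqP E0.
  have : (2%:E <= 0 :> \bar R)%E by apply: (le_trans h); rewrite le_eqVlt; apply/orP; left; apply/eqP.
  by rewrite lee_fin; lra.
- exact: integrable_horner_weight.
- move=> t [It /negP pt]; rewrite lt0r W0// andbT mulf_neq0//.
  by rewrite gt_eqF// W_gt0.
Qed.

End gegenbauer_weight.

(** * The derivative at the Radau nodes *)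

Section gegenbauer_radau.
Context {R : realType} (alpha : R) (halpha : - 2^-1 < alpha).
Context (G : nat -> {poly R}) (hG : gegenbauer_family alpha G).
Notation I := (gegenbauer_int alpha).

Let intD := gegenbauer_intD alpha halpha.
Let intZ := gegenbauer_intZ alpha halpha.

Let int0 : I 0 = 0.
Proof. by rewrite -(scale0r (0 : {poly R})) intZ mul0r. Qed.

Let intB p q : I (p - q) = I p - I q.
Proof. by rewrite intD -scaleN1r intZ mulN1r. Qed.

Let sizeG k : size (G k) = k.+1. Proof. by case: hG. Qed.

Let G_neq0 k : G k != 0. Proof. by rewrite -size_poly_eq0 sizeG. Qed.

(** The degrees of the [G m] increase by one, so they triangularize polynomials. *)
Lemma gegenbauer_lead_split m (q : {poly R}) : (size q <= m.+1)%N ->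
  exists2 q' : {poly R}, (size q' <= m)%N & q = (q`_m / lead_coef (G m)) *: G m + q'.
Proof.
move=> sq; exists (q - (q`_m / lead_coef (G m)) *: G m); last first.
  by rewrite addrC subrK.
have lG : lead_coef (G m) = (G m)`_m by rewrite lead_coefE sizeG.
apply/leq_sizeP => j; rewrite leq_eqVlt => /predU1P[<-|mj].
  by rewrite coefB coefZ lG divfK ?subrr// -lG lead_coef_eq0.
have qj : q`_j = 0 by rewrite nth_default// (leq_trans sq mj).
have Gj : (G m)`_j = 0 by rewrite nth_default// sizeG.
by rewrite coefB coefZ qj Gj mulr0 subrr.
Qed.

Lemma gegenbauer_int_orth n (q : {poly R}) : (size q <= n)%N -> I (G n * q) = 0.
Proof.
suff H m : (m <= n)%N -> (size q <= m)%N -> I (G n * q) = 0 by exact: H (leqnn n).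
elim: m q => [|m IH] q mn.
  by rewrite leqn0 size_poly_eq0 => /eqP ->; rewrite mulr0.
move=> /gegenbauer_lead_split[q' sq' ->].
rewrite mulrDr intD (IH q' (ltnW mn) sq') -scalerAr intZ.
have [_ + _] := hG => /(_ n m); rewrite gegenbauer_dotE// => ->.
  by rewrite mulr0 addr0.
by rewrite gt_eqF.
Qed.

Lemma gegenbauer_int_sqr_eq0 p : I (p * p) = 0 -> p = 0.
Proof.
move=> /(gegenbauer_int_eq0 alpha halpha) h.
have /eqP := h (fun t _ => ltac:(by rewrite hornerM -expr2 sqr_ge0)).
by rewrite mulf_eq0 orbb => /eqP.
Qed.

Context (n : nat) (hn : (0 < n)%N) (J : {poly R}).
Context (hJ : (1 + 'X) * J = G n + G n.+1).

Let size1X : size (1 + 'X : {poly R}) = 2.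
Proof. by rewrite addrC -polyC1 size_XaddC. Qed.

Let oneX_neq0 : 1 + 'X != 0 :> {poly R}.
Proof. by rewrite -size_poly_eq0 size1X. Qed.

Lemma size_radau_cofactor : size J = n.+1.
Proof.
have sP : size (G n + G n.+1) = n.+2.
  by rewrite addrC size_polyDl sizeG// sizeG.
have J0 : J != 0.
  by apply/eqP => J0; move: hJ; rewrite J0 mulr0 => P0; rewrite -P0 size_poly0 in sP.
by move: sP; rewrite -hJ size_mul// size1X add2n => -[].
Qed.

Let J_neq0 : J != 0. Proof. by rewrite -size_poly_eq0 size_radau_cofactor. Qed.

Lemma radau_cofactor_orth (r : {poly R}) : (size r <= n)%N ->
  I ((1 + 'X) * J * r) = 0.
Proof.
move=> rn; rewrite hJ mulrDl intD !gegenbauer_int_orth ?addr0//.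
exact: leqW.
Qed.

(** These are the conditions that remain of the orthogonality of [(1 + 'X) * J]
    to lower degrees when the factor [1 + 'X] is moved to the test polynomial;
    they fall short by one of forcing a polynomial of degree less than [n] to
    be zero. *)
Definition radau_perp (U : {poly R}) :=
  forall r : {poly R}, (size r < n)%N -> I (U * ((1 + 'X) * r)) = 0.

(** [U] is [(1 + 'X) * r] for an admissible [r], so it is orthogonal to itself.
    Hence the [U] of size at most [n] satisfying [radau_perp] are determined
    by their value at [-1], that is, they form at most a line. *)
Lemma radau_perp_eq0 (U : {poly R}) :
  (size U <= n)%N -> radau_perp U -> U.[-1] = 0 -> U = 0.
Proof.
move=> sU pU /rootP/factor_theorem[r UE].
have [->//|U0] := eqVneq U 0.
have r0 : r != 0 by apply: contraNneq U0 => r0; rewrite UE r0 mul0r.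
have UE' : U = (1 + 'X) * r by rewrite UE mulrC polyCN opprK polyC1 addrC.
apply: gegenbauer_int_sqr_eq0; rewrite {2}UE'; apply: pU.
by move: sU; rewrite UE' size_mul// size1X add2n.
Qed.

(** The multiple of [J] that is subtracted is harmless by [radau_cofactor_orth]:
    as the quotient has degree at most 1, its product with [r] has degree less
    than [n]. *)
Lemma radau_perp_modp (H : {poly R}) : (size H <= n.+2)%N ->
  radau_perp H -> radau_perp (H %% J).
Proof.
move=> sH pH r rn.
have -> : H %% J = H - (H %/ J) * J by rewrite {2}(divp_eq H J) addrC addKr.
rewrite mulrBl intB (pH r rn) sub0r.
have -> : H %/ J * J * ((1 + 'X) * r) = (1 + 'X) * J * (H %/ J * r) by ring.
rewrite radau_cofactor_orth ?oppr0//.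
apply: leq_trans (size_polyMleq _ _) _.
rewrite size_divp// size_radau_cofactor /=.
have sHn : (size H - n <= 2)%N by rewrite leq_subLR addn2.
have := leq_add sHn rn; move: (_ - _)%N (size r) => a b; lia.
Qed.

Lemma radau_perp_gegenbauer : radau_perp (G n).
Proof.
move=> r rn; apply: gegenbauer_int_orth.
by apply: leq_trans (size_polyMleq _ _) _; rewrite size1X.
Qed.

(** With [q = (1 + 'X) * r], the product rule writes the integrand as
    [gegenbauer_adjoint (J * q)], whose integral is zero, minus [J] times
    [(1 - 'X^2) * q^`() - (2 * alpha + 1) *: ('X * q)].  The factor [1 + 'X]
    of [q] makes the latter divisible by [1 + 'X], so that
    [radau_cofactor_orth] applies. *)
Lemma radau_perp_deriv : radau_perp ((1 - 'X^2) * J^`()).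
Proof.
move=> r rn; set q := (1 + 'X) * r.
have sq : (size q <= n)%N.
  by apply: leq_trans (size_polyMleq _ _) _; rewrite size1X.
have -> : (1 - 'X^2) * J^`() * q = gegenbauer_adjoint alpha (J * q)
    - (1 + 'X) * J * ((1 - 'X) * q^`() - (2 * alpha + 1) *: ('X * r)).
  rewrite /gegenbauer_adjoint derivM -!mul_polyC.
  have -> : 'X * (J * q) = (1 + 'X) * (J * ('X * r)) by rewrite /q; ring.
  move: (q^`()) (J^`()) => q' J'.
  ring.
rewrite intB gegenbauer_int_adjoint// radau_cofactor_orth ?subr0//.
apply: (leq_trans (size_polyD _ _)); rewrite size_polyN geq_max; apply/andP; split.
  have sq' : (size q^`() <= n.-1)%N.
    have [->|q0] := eqVneq q 0; first by rewrite deriv0 size_poly0.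
    by have := lt_size_deriv q0; move: sq; lia.
  apply: (leq_trans (size_polyMleq _ _)).
  have -> : size (1 - 'X : {poly R}) = 2.
    by rewrite -opprB size_polyN -polyC1 size_XsubC.
  by move: sq' hn; lia.
apply: (leq_trans (size_scale_leq _ _)); apply: (leq_trans (size_polyMleq _ _)).
by rewrite size_polyX.
Qed.

(** Otherwise [G n] would be a multiple of [J], so that [(1 + 'X) * G n] would be
    a combination of [G n] and [G n.+1], hence orthogonal to [G n.-1].  But
    [(1 + 'X) * G n.-1] has a nonzero component along [G n]. *)
Lemma gegenbauer_modp_neq0 : G n %% J != 0.
Proof.
apply/eqP => mod0.
have GE : G n = G n %/ J * J by rewrite {1}(divp_eq (G n) J) mod0 addr0.
have /size_poly1P[c c0 cE] : size (G n %/ J) == 1.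
  by rewrite size_divp// size_radau_cofactor sizeG subSnn.
have E0 : I (G n * ((1 + 'X) * G n.-1)) = 0.
  have -> : G n * ((1 + 'X) * G n.-1) = c *: (G n * G n.-1 + G n.+1 * G n.-1).
    by rewrite {1}GE cE -mul_polyC -mulrDl -hJ; ring.
  rewrite intZ intD !gegenbauer_int_orth ?addr0 ?mulr0// sizeG; lia.
have s1 : size ((1 + 'X) * G n.-1) = n.+1.
  by rewrite size_mul// size1X sizeG prednK.
have [|q' sq' E] := gegenbauer_lead_split n ((1 + 'X) * G n.-1); first by rewrite s1.
move: E0; rewrite E mulrDr intD (gegenbauer_int_orth _ _ sq') addr0 -scalerAr intZ.
move/eqP; rewrite mulf_eq0 => /orP[|/eqP/gegenbauer_int_sqr_eq0/eqP]; last exact/negP.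
rewrite mulf_eq0 invr_eq0 lead_coef_eq0 (negPf (G_neq0 n)) orbF.
have -> : ((1 + 'X) * G n.-1)`_n = lead_coef ((1 + 'X) * G n.-1).
  by rewrite lead_coefE s1.
by rewrite lead_coef_eq0 mulf_eq0 (negPf oneX_neq0) (negPf (G_neq0 _)).
Qed.

Let horner_modp (H : {poly R}) t : root J t -> (H %% J).[t] = H.[t].
Proof.
by move=> /rootP Jt; rewrite {2}(divp_eq H J) hornerD hornerM Jt mulr0 add0r.
Qed.

(** The remainders [S] and [T] of [(1 - 'X^2) * J^`()] and [G n] modulo [J] have
    the same values as these polynomials at the roots of [J], and lie on the line
    described by [radau_perp_eq0].  A single simple root [t0] suffices to see
    that [S] is not zero. *)
Lemma radau_deriv_at_roots (t0 : R) :
  root J t0 -> ~~ root J^`() t0 -> 1 - t0 ^+ 2 != 0 ->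
  exists2 A : R, A != 0 & forall t, root J t -> (1 - t ^+ 2) * J^`().[t] = A * (G n).[t].
Proof.
move=> Jt0 J't0 t01.
pose S := ((1 - 'X^2) * J^`()) %% J; pose T := G n %% J.
have Sroot t : root J t -> S.[t] = (1 - t ^+ 2) * J^`().[t].
  by move=> Jt; rewrite horner_modp// hornerM !hornerE.
have Troot t : root J t -> T.[t] = (G n).[t] by exact: horner_modp.
have sS : (size S <= n)%N.
  by rewrite -ltnS -size_radau_cofactor ltn_modp.
have sT : (size T <= n)%N.
  by rewrite -ltnS -size_radau_cofactor ltn_modp.
have pS : radau_perp S.
  apply: radau_perp_modp radau_perp_deriv.
  apply: (leq_trans (size_polyMleq _ _)).
  have -> : size (1 - 'X^2 : {poly R}) = 3.
    by rewrite -opprB size_polyN -polyC1 size_XnsubC.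
  by have := lt_size_deriv J_neq0; rewrite size_radau_cofactor; lia.
have pT : radau_perp T.
  by apply: radau_perp_modp radau_perp_gegenbauer; rewrite sizeG.
have S1 : S.[-1] != 0.
  apply/eqP => /(radau_perp_eq0 _ sS pS) S0.
  have := Sroot _ Jt0; rewrite S0 horner0 => /esym/eqP.
  by rewrite mulf_eq0 (negPf t01) -rootE (negPf J't0).
have T1 : T.[-1] != 0.
  apply/eqP => /(radau_perp_eq0 _ sT pT) T0.
  by move: gegenbauer_modp_neq0; rewrite -/T T0 eqxx.
have ST : S.[-1] *: T = T.[-1] *: S.
  apply/eqP; rewrite -subr_eq0; apply/eqP; apply: radau_perp_eq0.
  - apply: (leq_trans (size_polyD _ _)); rewrite size_polyN geq_max.
    by rewrite !(leq_trans (size_scale_leq _ _)).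
  - move=> r rn; rewrite mulrBl intB -!scalerAl !intZ pS// pT//.
    by rewrite !mulr0 subrr.
  - by rewrite hornerD hornerN !hornerZ mulrC subrr.
exists (S.[-1] / T.[-1]); first by rewrite mulf_neq0// invr_eq0.
move=> t Jt; rewrite -Sroot// -Troot//.
apply: (mulfI T1); rewrite -hornerZ -ST hornerZ.
by field.
Qed.

(** If [J = M * ('X - t)] with [t >= 1], then
    [(1 + 'X) * (t - 'X) * M ^ 2], which is nonnegative on the interval, has zero
    integral because [(1 + 'X) * J] is orthogonal to [M]. *)
Lemma radau_root_lt1 (t : R) : root J t -> t < 1.
Proof.
move=> /factor_theorem[M JE]; rewrite ltNge; apply/negP => t1.
have M0 : M != 0 by apply: contraNneq J_neq0 => M0; rewrite JE M0 mul0r.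
have sM : (size M <= n)%N.
  by move: size_radau_cofactor; rewrite JE size_Mmonic ?monicXsubC// size_XsubC addn2 => -[->].
pose Q := (1 + 'X) * (t%:P - 'X) * (M * M).
have : Q = 0.
  apply: (gegenbauer_int_eq0 alpha halpha).
    move=> x /andP[x1 x2]; rewrite !hornerM; apply: mulr_ge0; last by rewrite -expr2 sqr_ge0.
    by apply: mulr_ge0; rewrite !hornerE; lra.
  have -> : Q = 0 - (1 + 'X) * J * M by rewrite /Q JE; ring.
  by rewrite intB int0 radau_cofactor_orth// subr0.
apply/eqP; rewrite !mulf_neq0//.
by rewrite -opprB oppr_eq0 polyXsubC_eq0.
Qed.

End gegenbauer_radau.

(** * Barycentric weights *)

Lemma sin_half_acos (R : realType) (x : R) : -1 <= x <= 1 ->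
  sin (2^-1 * acos x) = Num.sqrt ((1 - x) / 2).
Proof.
move=> x1; have [/andP[a0 api] ca] := acos_def x1.
have h := cos_mulr2n (2^-1 * acos x).
have e2 : (2^-1 * acos x) *+ 2 = acos x by rewrite mulr2n; lra.
rewrite e2 ca mulr2n in h.
have s0 : 0 <= sin (2^-1 * acos x).
  by apply: sin_ge0_pi; apply/andP; split; lra.
have -> : (1 - x) / 2 = sin (2^-1 * acos x) ^+ 2.
  by have := cos2Dsin2 (2^-1 * acos x); lra.
by rewrite sqrtr_sqr ger0_norm.
Qed.

(** Exactly the [i] factors with [j < i] are negative. *)
Lemma bary_prod_sign (R : realType) n (tau : 'I_n.+1 -> R) (i : 'I_n.+1) :
  (forall i j : 'I_n.+1, (i < j)%N -> tau i < tau j) ->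
  \prod_(j < n.+1 | j != i) (tau j - tau i) =
    (-1) ^+ i * `|\prod_(j < n.+1 | j != i) (tau i - tau j)|.
Proof.
move=> mono.
have -> : (-1) ^+ i = \prod_(j < n.+1 | j != i) (if (j < i)%N then -1 else 1 : R).
  rewrite -big_mkcondr/=.
  rewrite (eq_bigl (fun j : 'I_n.+1 => (j < i)%N)); last first.
    move=> j; case: ltngtP => [ji|ji|ji]; rewrite ?andbF ?andbT//.
    by apply/negP => /eqP ji'; rewrite ji' ltnn in ji.
  by rewrite -(big_ord_widen n.+1 (fun _ => -1 : R))// ?prodr_const ?card_ord// ltnW.
rewrite normr_prod -big_split/=; apply: eq_bigr => j ji.
case: ltngtP => [jlt|jgt|/ord_inj je]; last by rewrite je eqxx in ji.
  by rewrite gtr0_norm ?subr_gt0 ?mono// mulN1r opprB.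
by rewrite ltr0_norm ?subr_lt0 ?mono// mul1r opprB.
Qed.

Section ggr_nodes.
Context {R : realType} (alpha : R) (halpha : - 2^-1 < alpha).
Context (n : nat) (hn : (0 < n)%N).
Context (G : nat -> {poly R}) (hG : gegenbauer_family alpha G).
Context (tau : 'I_n.+1 -> R) (htau : ggr_points G tau).

Let tau_inj : injective tau.
Proof.
case: htau => _ mono _ i j tij; apply: ord_inj.
by case: (ltngtP i j) => // /mono; rewrite tij ltxx.
Qed.

Lemma ggr_poly_factor : exists2 k : R, k != 0 &
  G n + G n.+1 = k *: \prod_(i < n.+1) ('X - (tau i)%:P).
Proof.
have [_ _ rootP'] := htau; have [sizeG _ _] := hG.
have sP : size (G n + G n.+1) = n.+2 by rewrite addrC size_polyDl sizeG// sizeG.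
exists (lead_coef (G n + G n.+1)).
  by rewrite lead_coef_eq0 -size_poly_eq0 sP.
rewrite [LHS](@all_roots_prod_XsubC _ _ [seq tau i | i : 'I_n.+1]).
- by rewrite big_image.
- by rewrite size_map size_enum_ord.
- by apply/allP => x /mapP[i _ ->]; apply/rootP'; exists i.
- by rewrite uniq_rootsE map_inj_uniq// enum_uniq.
Qed.

(** The two sides are [(1 - t) * P'(t)] and [A * G_n(t)] at [t = tau i]; the
    derivative of [P = k * \prod_j ('X - tau j)] is [k] times the product over
    the other nodes, and also [(1 + t) * J'(t)] as [J] vanishes there. *)
Lemma ggr_derivative : exists k A : R, [/\ k != 0, A != 0 &
  forall i : 'I_n.+1, (1 <= i)%N -> -1 < tau i < 1 /\
    (1 - tau i) * (k * \prod_(j < n.+1 | j != i) (tau i - tau j)) =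
      A * (G n).[tau i]].
Proof.
have [k k0 PE] := ggr_poly_factor.
have [tau0 mono _] := htau.
pose J := k *: \prod_(i < n.+1 | i != ord0) ('X - (tau i)%:P).
have JE : (1 + 'X) * J = G n + G n.+1.
  rewrite PE (bigD1 ord0)//= tau0 -scalerAr; congr (_ *: (_ * _)).
  by rewrite polyCN opprK polyC1 addrC.
have Jroot (i : 'I_n.+1) : (1 <= i)%N -> root J (tau i).
  move=> i1; rewrite /J rootZ// (bigD1 i)/=; last by rewrite -val_eqE/=; lia.
  by rewrite rootM root_XsubC eqxx.
have PQ (i : 'I_n.+1) : (G n + G n.+1)^`().[tau i] = k * \prod_(j < n.+1 | j != i) (tau i - tau j).
  rewrite PE derivZ (bigD1 i)//= derivM derivXsubC hornerZ; congr (_ * _).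
  rewrite hornerD !hornerM hornerXsubC subrr mul0r addr0 hornerC mul1r.
  by rewrite horner_prod; apply: eq_bigr => j _; rewrite hornerXsubC.
have PJ (i : 'I_n.+1) : (1 <= i)%N -> (G n + G n.+1)^`().[tau i] = (1 + tau i) * J^`().[tau i].
  move=> /Jroot/rootP Ji; rewrite -JE derivM hornerD !hornerM Ji mulr0 add0r.
  by rewrite !hornerE.
have prod0 (i : 'I_n.+1) : k * \prod_(j < n.+1 | j != i) (tau i - tau j) != 0.
  rewrite mulf_neq0//; apply/prodf_neq0 => j ji.
  by rewrite subr_eq0; apply: contra ji => /eqP/tau_inj ->.
have bnd (i : 'I_n.+1) : (1 <= i)%N -> -1 < tau i < 1.
  move=> i1; rewrite -{1}tau0 mono//=.
  exact: (radau_root_lt1 alpha halpha G hG n J JE _ (Jroot i i1)).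
pose i1 : 'I_n.+1 := Ordinal (hn : (1 < n.+1)%N).
have [||A A0 hA] := radau_deriv_at_roots alpha halpha G hG n hn J JE (tau i1) (Jroot i1 isT).
- apply: contra (prod0 i1) => /rootP J'0; rewrite -PQ PJ// J'0 mulr0.
  by [].
- have /andP[h1 h2] := bnd i1 isT.
  have -> : 1 - tau i1 ^+ 2 = (1 - tau i1) * (1 + tau i1) by ring.
  by rewrite mulf_neq0//; apply/eqP; lra.
exists k, A; split=> // i i_ge1; split; first exact: bnd.
rewrite -hA ?Jroot// -PQ PJ//; ring.
Qed.

End ggr_nodes.

Local Close Scope classical_set_scope.

Theorem theorem4p2 (R : realType) (alpha : R) (halpha : - 2^-1 < alpha)
    (n : nat) (hn : (0 < n)%N)
    (G : nat -> {poly R}) (hG : gegenbauer_family alpha G)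
    (tau : 'I_n.+1 -> R) (htau : ggr_points G tau) :
  exists2 c : R, c != 0 &
    forall i : 'I_n.+1, (1 <= i)%N ->
      let varpi := ggr_christoffel alpha G tau i in
      bary_weight tau i =
        c * ((-1) ^+ (i - 1) * sin (2^-1 * acos (tau i)) * Num.sqrt (2 * varpi))
      /\
      (-1) ^+ (i - 1) * sin (2^-1 * acos (tau i)) * Num.sqrt (2 * varpi) =
        (-1) ^+ (i - 1) * sin (acos (tau i)) * Num.sqrt (varpi / (1 + tau i)).
Proof.
have [k [A [k0 A0 nodes]]] := ggr_derivative alpha halpha n hn G hG tau htau.
have [_ mono _] := htau.
pose K : R := 2 `^ (2 * alpha - 1) *
  (Gamma (alpha + 2^-1) ^+ 2 * n`!%:R /
     ((n%:R + alpha + 2^-1) * Gamma (n%:R + 2 * alpha + 1))).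
have n1 : 1 <= n%:R :> R by rewrite ler1n.
have K0 : 0 < K.
  rewrite mulr_gt0 ?powR_gt0// divr_gt0// mulr_gt0 ?ltr0n ?fact_gt0//.
  - by rewrite exprn_gt0// Gamma_gt0//; lra.
  - by lra.
  - by rewrite Gamma_gt0//; lra.
(* The minus sign: the weight of node [i] has the sign [(-1) ^+ i], while the
   closed form has the sign [(-1) ^+ (i - 1)]. *)
exists (- (`|k| / (`|A| * Num.sqrt K))).
  by rewrite oppr_eq0 mulf_neq0 ?invr_eq0 ?mulf_neq0 ?normr_eq0// gt_eqF// sqrtr_gt0.
move=> i i1 varpi.
have [/andP[t1 t2] hA] := nodes i i1.
have tle : -1 <= tau i <= 1 by rewrite !ltW.
have i0 : i == ord0 = false by apply/eqP => i0; rewrite i0 in i1.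
have varpiE : varpi = K * (1 - tau i) * (G n).[tau i] ^- 2.
  by rewrite /varpi /ggr_christoffel i0.
have halfE : sin (2^-1 * acos (tau i)) * Num.sqrt (2 * varpi) = Num.sqrt ((1 - tau i) * varpi).
  rewrite sin_half_acos// -sqrtrM; last by apply: divr_ge0 => //; lra.
  by congr Num.sqrt; field.
split; last first.
  rewrite -!mulrA; congr (_ * _); rewrite halfE sin_acos// -sqrtrM; last by nra.
  by congr Num.sqrt; field; apply/eqP; lra.
rewrite -mulrA halfE /bary_weight bary_prod_sign//.
set D := \prod_(j < n.+1 | _) _ in hA *.
have D0 : D != 0.
  apply/prodf_neq0 => j ji; rewrite subr_eq0 neq_lt.
  by case: (ltngtP i j) => [/mono ->|/mono ->|/ord_inj ij]; rewrite ?orbT// ij eqxx in ji *.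
have g0 : (G n).[tau i] != 0.
  apply/eqP => g0; move/eqP: hA; rewrite g0 mulr0 mulf_eq0 mulf_eq0 (negPf k0) (negPf D0) !orbF.
  by apply/negP/eqP; lra.
have -> : Num.sqrt ((1 - tau i) * varpi) = Num.sqrt K * (1 - tau i) / `|(G n).[tau i]|.
  rewrite varpiE.
  have -> : (1 - tau i) * (K * (1 - tau i) * (G n).[tau i] ^- 2) =
     K * ((1 - tau i) / (G n).[tau i]) ^+ 2 by field.
  rewrite sqrtrM ?(ltW K0)// sqrtr_sqr normf_div (ger0_norm (_ : 0 <= 1 - tau i)) ?mulrA//; lra.
have hN : (1 - tau i) * (`|k| * `|D|) = `|A| * `|(G n).[tau i]|.
  by rewrite -!normrM -hA !normrM (gtr0_norm (_ : 0 < 1 - tau i))//; lra.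
have -> : (-1) ^+ i = - (-1) ^+ (i - 1) :> R.
  by rewrite -{1}(subnK i1) addn1 exprS mulN1r.
have nD : `|D| != 0 by rewrite normr_eq0.
have nk : `|k| != 0 by rewrite normr_eq0.
have nA : `|A| != 0 by rewrite normr_eq0.
have ng : `|(G n).[tau i]| != 0 by rewrite normr_eq0.
have sK : Num.sqrt K != 0 by rewrite gt_eqF// sqrtr_gt0.
set s : R := (-1) ^+ (i - 1).
have DE : `|D| = `|A| * `|(G n).[tau i]| / ((1 - tau i) * `|k|).
  by rewrite -hN; field; rewrite nk; apply/eqP; lra.
have -> : (- s * `|D|)^-1 = - (s * `|D|^-1).
  rewrite mulNr invrN invfM; congr (- (_ * _)).
  by rewrite /s -signr_odd; case: odd; rewrite ?expr1 ?invrN1 ?expr0 ?invr1.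
rewrite DE; field.
rewrite nk nA ng sK /=.
by apply/eqP; lra.
Qed.
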